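(* Let $m\ge 1$ be an integer and let $W$ be an arbitrary B-DMC. For every $\delta\in(0,1)$, $$\lim_{n\to\infty}\frac{\bigl|\{\mathbf s\in\mathcal S_n:\ I(W_{\mathbf s})\in(1-\delta,1]\}\bigr|}{N(n)}=I(W) \quad\text{and}\quad \lim_{n\to\infty}\frac{\bigl|\{\mathbf s\in\mathcal S_n:\ I(W_{\mathbf s})\in[0,\delta)\}\bigr|}{N(n)}=1-I(W).$$ Equivalently, if $\mathbf S_n$ is uniformly distributed on $\mathcal S_n$ and $I_n=I(W_{\mathbf S_n})$, then $\Pr(I_n>1-\delta)\to I(W)$ and $\Pr(I_n<\delta)\to 1-I(W)$.
   Context: Fix an integer $m\ge1$. Define integers $N(n)$ by $N(n)=1$ for $1-m\le n\le 0$ and $N(n)=N(n-1)+N(n-m)$ for $n\ge1$; write $\mathbb N_n=\{1,\dots,N(n)\}$ (so $\mathbb N_n=\{1\}$ for $n\le 0$, and $\mathbb N_{n-m}\subseteq\mathbb N_{n-1}$). Define vectors $\mathbf s_n^{(i)}\in\{+,-,\bigstar\}^n$ for $n\ge0$, $i\in\mathbb N_n$, recursively: $\mathbf s_0^{(1)}$ is the empty vector, and for $n\ge1$: $\mathbf s_n^{(j)}=(\mathbf s_{n-1}^{(j)},+)$ and $\mathbf s_n^{(j+N(n-1))}=(\mathbf s_{n-1}^{(j)},-)$ for $j\in\mathbb N_{n-m}$, while $\mathbf s_n^{(j)}=(\mathbf s_{n-1}^{(j)},\bigstar)$ for $j\in\mathbb N_{n-1}\setminus\mathbb N_{n-m}$.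 Let $\mathcal S_n=\{\mathbf s_n^{(i)}:i\in\mathbb N_n\}$ for $n\ge1$. A B-DMC $V$ is a channel with input alphabet $\{0,1\}$, a finite output alphabet $\mathcal Y$ and transition probabilities $V(y|x)$. With base-2 logarithms and uniform input: $I(V)=\sum_{y}\sum_{x}\frac12V(y|x)\log\frac{V(y|x)}{\frac12V(y|0)+\frac12V(y|1)}$, $Z(V)=\sum_y\sqrt{V(y|0)V(y|1)}$, $J(V)=\log\frac{2}{1+Z(V)}$. For B-DMCs $V':\{0,1\}\to\mathcal Y_1$ and $V'':\{0,1\}\to\mathcal Y_2$ define $V'\boxminus V'':\{0,1\}\to\mathcal Y_1\times\mathcal Y_2$ by $(V'\boxminus V'')(y_1,y_2|x_1)=\sum_{x_2\in\{0,1\}}\frac12V'(y_1|x_1\oplus x_2)V''(y_2|x_2)$, and $V'\boxplus V'':\{0,1\}\to\mathcal Y_1\times\mathcal Y_2\times\{0,1\}$ by $(V'\boxplus V'')(y_1,y_2,x_1|x_2)=\frac12V'(y_1|x_1\oplus x_2)V''(y_2|x_2)$. Fix a B-DMC $W$. For every finite string $\mathbf t=(t_1,\dots,t_n)\in\{+,-,\bigstar\}^n$, $n\ge0$, define a B-DMC $W_{\mathbf t}$ recursively: $W_{\emptyset}=W$ for the empty string; for $n\ge1$ let $\mathbf t'=(t_1,\dots,t_{n-1})$ and $\mathbf t''=(t_1,\dots,t_{n-m})$ (the empty string if $n\le m$); then $W_{\mathbf t}=W_{\mathbf t''}\boxplus W_{\mathbf t'}$ if $t_n=+$, $W_{\mathbf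 t}=W_{\mathbf t''}\boxminus W_{\mathbf t'}$ if $t_n=-$, and $W_{\mathbf t}=W_{\mathbf t'}$ if $t_n=\bigstar$. (For $\mathbf s\in\mathcal S_n$, $W_{\mathbf s}$ models the synthesized bit-channel with state vector $\mathbf s$ of the polar code with memory $m$; in the paper's $\bigstar$ case the channel has extra independent outputs, which does not change $I$, $Z$ or $J$.) *)

(* Defs.v *)
From Stdlib Require Import Reals List Arith Lia.
Import ListNotations.
Open Scope R_scope.

(* A B-DMC with finite output alphabet Y = {0,...,k-1} is represented by the
   list of pairs (V(y|0), V(y|1)) for y = 0,...,k-1. *)
Definition channel := list (R * R).

Definition sumR (l : list R) : R := fold_right Rplus 0 l.

Definition is_BDMC (V : channel) : Prop :=
  Forall (fun p => 0 <= fst p /\ 0 <= snd p) V /\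
  sumR (map fst V) = 1 /\ sumR (map snd V) = 1.

Definition log2 (x : R) : R := ln x / ln 2.

(* p * log2 (p / a), with the convention 0 log 0 = 0. *)
Definition xlog (p a : R) : R :=
  if Req_EM_T p 0 then 0 else p * log2 (p / a).

Definition I (V : channel) : R :=
  sumR (map (fun p =>
     let a := / 2 * fst p + / 2 * snd p in
     / 2 * xlog (fst p) a + / 2 * xlog (snd p) a) V).

(* V' ⊟ V'' : output (y1,y2), input x1 *)
Definition bminus (V1 V2 : channel) : channel :=
  flat_map (fun a => map (fun b =>
     (/ 2 * (fst a * fst b + snd a * snd b),
      / 2 * (snd a * fst b + fst a * snd b))) V2) V1.

(* V' ⊞ V'' : output (y1,y2,x1), input x2 *)
Definition bplus (V1 V2 : channel) : channel :=
  flat_map (fun a => flat_map (fun b =>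
     [ (/ 2 * (fst a * fst b), / 2 * (snd a * snd b))    (* x1 = 0 *)
     ; (/ 2 * (snd a * fst b), / 2 * (fst a * snd b)) ]) (* x1 = 1 *)
     V2) V1.

Inductive sign := Plus | Minus | Star.

(* W_t, defined by recursion on the length of t (fuel = length t).
   t = (t_1,...,t_n) is the list [t_1; ...; t_n]. *)
Fixpoint Wt_aux (m : nat) (W : channel) (fuel : nat) (t : list sign) : channel :=
  match fuel with
  | O => W
  | S f =>
    match rev t with
    | [] => W
    | tn :: rt' =>
      let t' := rev rt' in
      let t'' := firstn (length t - m) t in
      match tn with
      | Plus => bplus (Wt_aux m W f t'') (Wt_aux m W f t')
      | Minus => bminus (Wt_aux m W f t'') (Wt_aux m W f t')
      | Star => Wt_aux m W f t'
      end
    end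
  end.

Definition Wt (m : nat) (W : channel) (t : list sign) : channel :=
  Wt_aux m W (length t) t.

(* N(n): N(n) = 1 for n <= 0, N(n) = N(n-1) + N(n-m) for n >= 1.
   (truncated subtraction n - m maps indices <= 0 to 0, where N = 1) *)
Fixpoint N_aux (m : nat) (fuel n : nat) : nat :=
  match fuel with
  | O => 1
  | S f => match n with
           | O => 1
           | S n' => (N_aux m f n' + N_aux m f (n - m))%nat
           end
  end.

Definition Ncount (m n : nat) : nat := N_aux m n n.

(* The ordered list [s_n^(1); ...; s_n^(N(n))]. *)
Fixpoint Slist (m n : nat) : list (list sign) :=
  match n with
  | O => [ [] ]
  | S n' =>
    let prev := Slist m n' in
    let k := Ncount m (n - m) in
    map (fun s => s ++ [Plus]) (firstn k prev) ++
    map (fun s => s ++ [Star]) (skipn k prev) ++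
    map (fun s => s ++ [Minus]) (firstn k prev)
  end.

Definition in_high (d x : R) : bool :=
  if Rlt_dec (1 - d) x then (if Rle_dec x 1 then true else false) else false.

Definition in_low (d x : R) : bool :=
  if Rle_dec 0 x then (if Rlt_dec x d then true else false) else false.

Definition count_high (m : nat) (W : channel) (d : R) (n : nat) : nat :=
  length (filter (fun s => in_high d (I (Wt m W s))) (Slist m n)).

Definition count_low (m : nat) (W : channel) (d : R) (n : nat) : nat :=
  length (filter (fun s => in_low d (I (Wt m W s))) (Slist m n)).

Example N_test : map (Ncount 2) [0;1;2;3;4;5]%nat = [1;2;3;5;8;13]%nat.
Proof. reflexivity. Qed.
Example S_test : Slist 1 2 = [[Plus;Plus];[Minus;Plus];[Plus;Minus];[Minus;Minus]].
Proof. reflexivity. Qed.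
Example S_len : length (Slist 3 6) = Ncount 3 6.
Proof. reflexivity. Qed.

(* Main.v *)
Require Import Defs.
From Stdlib Require Import Reals List Arith Lra Lia Psatz.
Import ListNotations.
Open Scope R_scope.

(** Write [Z] for the Bhattacharyya parameter ([Zpar] below).  The chain rule
    [I (V1 ⊞ V2) + I (V1 ⊟ V2) = I V1 + I V2] keeps the average of [I] over the
    states equal to [I W], and [I] is within [O(Z)] of [1] and within [O(1 - Z)]
    of [0], so it suffices that the average of [Z (1 - Z)] tends to [0].

    From [Z (V1 ⊞ V2) = Z1 Z2] and [Z (V1 ⊟ V2) <= Z1 + Z2 - Z1 Z2], a
    polarization step lowers the sum of [ln (1 + Z)] by at least
    [Z1 (1 - Z1) Z2 (1 - Z2) / 4].  An index created (by a minus step) at time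
    [k] keeps its channel until time [k + m - 1], so at time [k + m] it is
    combined with itself.  Solving [x + x ^ m = 1] gives a Lyapunov function for
    the recurrence of [N], whose monotonicity forces the average of
    [(Z (1 - Z))^2] over the indices created at time [k] to tend to [0].

    After its creation an index only undergoes plus and idle steps, which
    multiply [Z (1 - Z)] by at most [2 ^ a] in time [a]; as [N] grows
    exponentially, all but a small fraction of the indices have bounded age. *)

(** * Finite sums of reals *)

Lemma sumR_app l1 l2 : sumR (l1 ++ l2) = sumR l1 + sumR l2.
Proof. induction l1 as [|x l1 IH]; simpl; [|rewrite IH]; lra. Qed.

Lemma sumR_map_ext_in {A} (f g : A -> R) l :
  (forall x, In x l -> f x = g x) -> sumR (map f l) = sumR (map g l).
Proof. intros H; f_equal; now apply map_ext_in. Qed.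

Lemma sumR_map_le {A} (f g : A -> R) l :
  (forall x, In x l -> f x <= g x) -> sumR (map f l) <= sumR (map g l).
Proof.
  induction l as [|x l IH]; simpl; intros H; [lra|].
  apply Rplus_le_compat; auto.
Qed.

Lemma sumR_map_plus {A} (f g : A -> R) l :
  sumR (map (fun x => f x + g x) l) = sumR (map f l) + sumR (map g l).
Proof. induction l as [|x l IH]; simpl; [|rewrite IH]; lra. Qed.

Lemma sumR_map_scal {A} c (f : A -> R) l :
  sumR (map (fun x => c * f x) l) = c * sumR (map f l).
Proof. induction l as [|x l IH]; simpl; [|rewrite IH]; lra. Qed.

Lemma sumR_map_const {A} c (l : list A) :
  sumR (map (fun _ => c) l) = INR (length l) * c.
Proof.
  induction l as [|x l IH]; [simpl; lra|].
  change (c + sumR (map (fun _ => c) l) = INR (S (length l)) * c).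
  rewrite IH, S_INR; lra.
Qed.

Lemma sumR_map_nonneg {A} (f : A -> R) l :
  (forall x, In x l -> 0 <= f x) -> 0 <= sumR (map f l).
Proof.
  intros H; apply Rle_trans with (sumR (map (fun _ : A => 0) l)).
  - rewrite sumR_map_const; lra.
  - now apply sumR_map_le.
Qed.

Lemma sumR_flat_map {A B} (f : B -> R) (g : A -> list B) l :
  sumR (map f (flat_map g l)) = sumR (map (fun a => sumR (map f (g a))) l).
Proof.
  induction l as [|x l IH]; simpl; [reflexivity|].
  now rewrite map_app, sumR_app, IH.
Qed.

Lemma length_filter_sumR {A} (p : A -> bool) l :
  INR (length (filter p l)) = sumR (map (fun s => if p s then 1 else 0) l).
Proof.
  induction l as [|x l IH]; [reflexivity|].
  cbn [filter map]; unfold sumR in *; cbn [fold_right]; rewrite <- IH.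
  destruct (p x); cbn [length]; [rewrite S_INR|]; lra.
Qed.

(** * Sums over output alphabets, single and in pairs *)

Definition sum_outputs (f : R * R -> R) (V : channel) : R := sumR (map f V).

Lemma sum_outputs_bminus f V1 V2 :
  sum_outputs f (bminus V1 V2) =
  sum_outputs (fun a => sum_outputs (fun b =>
     f (/ 2 * (fst a * fst b + snd a * snd b),
        / 2 * (snd a * fst b + fst a * snd b))) V2) V1.
Proof.
  unfold sum_outputs, bminus; rewrite sumR_flat_map.
  apply sumR_map_ext_in; intros a _; now rewrite map_map.
Qed.

Lemma sum_outputs_bplus f V1 V2 :
  sum_outputs f (bplus V1 V2) =
  sum_outputs (fun a => sum_outputs (fun b =>
     f (/ 2 * (fst a * fst b), / 2 * (snd a * snd b)) +
     f (/ 2 * (snd a * fst b), / 2 * (fst a * snd b))) V2) V1.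
Proof.
  unfold sum_outputs, bplus; rewrite sumR_flat_map.
  apply sumR_map_ext_in; intros a _; rewrite sumR_flat_map.
  apply sumR_map_ext_in; intros b _; simpl; lra.
Qed.

Lemma sum_outputs_prod (f g : R * R -> R) V1 V2 :
  sum_outputs (fun a => sum_outputs (fun b => f a * g b) V2) V1 =
  sum_outputs f V1 * sum_outputs g V2.
Proof.
  unfold sum_outputs.
  rewrite (sumR_map_ext_in _ (fun a => sumR (map g V2) * f a)).
  - rewrite sumR_map_scal; ring.
  - intros a _; rewrite sumR_map_scal; ring.
Qed.

Lemma sum_outputs_pair_plus (f g : R * R -> R * R -> R) V1 V2 :
  sum_outputs (fun a => sum_outputs (fun b => f a b + g a b) V2) V1 =
  sum_outputs (fun a => sum_outputs (f a) V2) V1 +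
  sum_outputs (fun a => sum_outputs (g a) V2) V1.
Proof.
  unfold sum_outputs; rewrite <- sumR_map_plus.
  apply sumR_map_ext_in; intros a _; apply sumR_map_plus.
Qed.

Lemma sum_outputs_pair_ext (f g : R * R -> R * R -> R) V1 V2 :
  (forall a b, In a V1 -> In b V2 -> f a b = g a b) ->
  sum_outputs (fun a => sum_outputs (f a) V2) V1 =
  sum_outputs (fun a => sum_outputs (g a) V2) V1.
Proof.
  intros H; apply sumR_map_ext_in; intros a Ha.
  apply sumR_map_ext_in; auto.
Qed.

Lemma sum_outputs_pair_le (f g : R * R -> R * R -> R) V1 V2 :
  (forall a b, In a V1 -> In b V2 -> f a b <= g a b) ->
  sum_outputs (fun a => sum_outputs (f a) V2) V1 <=
  sum_outputs (fun a => sum_outputs (g a) V2) V1.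
Proof.
  intros H; apply sumR_map_le; intros a Ha.
  apply sumR_map_le; auto.
Qed.

(** * Contributions of single outputs; closure of B-DMCs under the two transforms *)

Definition out_prob (p : R * R) : R := / 2 * fst p + / 2 * snd p.

Definition out_Z (p : R * R) : R := sqrt (fst p * snd p).

Definition Zpar (V : channel) : R := sum_outputs out_Z V.

Definition out_I (p : R * R) : R :=
  / 2 * xlog (fst p) (out_prob p) + / 2 * xlog (snd p) (out_prob p).

Definition nonneg_pair (p : R * R) : Prop := 0 <= fst p /\ 0 <= snd p.

Lemma BDMC_nonneg V p : is_BDMC V -> In p V -> nonneg_pair p.
Proof. intros [H _] Hp; rewrite Forall_forall in H; now apply H. Qed.

Lemma BDMC_out_prob V : is_BDMC V -> sum_outputs out_prob V = 1.
Proof.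
  intros [_ [H0 H1]]; unfold sum_outputs, out_prob.
  rewrite sumR_map_plus, !sumR_map_scal.
  change (map (fun x => fst x) V) with (map fst V).
  change (map (fun x => snd x) V) with (map snd V).
  rewrite H0, H1; lra.
Qed.

Lemma BDMC_intro V :
  (forall p, In p V -> nonneg_pair p) ->
  sum_outputs fst V = 1 -> sum_outputs snd V = 1 -> is_BDMC V.
Proof. intros H H0 H1; split; [now apply Forall_forall|now split]. Qed.

Lemma bminus_BDMC V1 V2 : is_BDMC V1 -> is_BDMC V2 -> is_BDMC (bminus V1 V2).
Proof.
  intros H1 H2; pose proof H1 as [_ [E1 F1]]; pose proof H2 as [_ [E2 F2]].
  fold (sum_outputs fst V1) in E1; fold (sum_outputs snd V1) in F1.
  fold (sum_outputs fst V2) in E2; fold (sum_outputs snd V2) in F2.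
  apply BDMC_intro.
  - intros p Hp; unfold bminus in Hp; apply in_flat_map in Hp as [a [Ha Hp]].
    apply in_map_iff in Hp as [b [<- Hb]].
    destruct (BDMC_nonneg _ _ H1 Ha), (BDMC_nonneg _ _ H2 Hb).
    split; simpl; nra.
  - rewrite sum_outputs_bminus; simpl.
    rewrite (sum_outputs_pair_ext _
       (fun a b => / 2 * fst a * fst b + / 2 * snd a * snd b)) by (intros; ring).
    rewrite sum_outputs_pair_plus, !(sum_outputs_prod (fun a => / 2 * _)).
    unfold sum_outputs in *; rewrite !sumR_map_scal.
    change (fun x : R * R => fst x) with (@fst R R).
    change (fun x : R * R => snd x) with (@snd R R).
    rewrite E1, E2, F1, F2; lra.
  - rewrite sum_outputs_bminus; simpl.
    rewrite (sum_outputs_pair_ext _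
       (fun a b => / 2 * snd a * fst b + / 2 * fst a * snd b)) by (intros; ring).
    rewrite sum_outputs_pair_plus, !(sum_outputs_prod (fun a => / 2 * _)).
    unfold sum_outputs in *; rewrite !sumR_map_scal.
    change (fun x : R * R => fst x) with (@fst R R).
    change (fun x : R * R => snd x) with (@snd R R).
    rewrite E1, E2, F1, F2; lra.
Qed.

Lemma bplus_BDMC V1 V2 : is_BDMC V1 -> is_BDMC V2 -> is_BDMC (bplus V1 V2).
Proof.
  intros H1 H2; pose proof H1 as [_ [E1 F1]]; pose proof H2 as [_ [E2 F2]].
  fold (sum_outputs fst V1) in E1; fold (sum_outputs snd V1) in F1.
  fold (sum_outputs fst V2) in E2; fold (sum_outputs snd V2) in F2.
  apply BDMC_intro.
  - intros p Hp; unfold bplus in Hp; apply in_flat_map in Hp as [a [Ha Hp]].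
    apply in_flat_map in Hp as [b [Hb Hp]].
    destruct (BDMC_nonneg _ _ H1 Ha), (BDMC_nonneg _ _ H2 Hb).
    destruct Hp as [<-|[<-|[]]]; split; simpl; nra.
  - rewrite sum_outputs_bplus; simpl.
    rewrite (sum_outputs_pair_ext _
       (fun a b => / 2 * fst a * fst b + / 2 * snd a * fst b)) by (intros; ring).
    rewrite sum_outputs_pair_plus, !(sum_outputs_prod (fun a => / 2 * _)).
    unfold sum_outputs in *; rewrite !sumR_map_scal.
    change (fun x : R * R => fst x) with (@fst R R).
    change (fun x : R * R => snd x) with (@snd R R).
    rewrite E1, E2, F1; lra.
  - rewrite sum_outputs_bplus; simpl.
    rewrite (sum_outputs_pair_ext _
       (fun a b => / 2 * snd a * snd b + / 2 * fst a * snd b)) by (intros; ring).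
    rewrite sum_outputs_pair_plus, !(sum_outputs_prod (fun a => / 2 * _)).
    unfold sum_outputs in *; rewrite !sumR_map_scal.
    change (fun x : R * R => fst x) with (@fst R R).
    change (fun x : R * R => snd x) with (@snd R R).
    rewrite E1, F1, F2; lra.
Qed.

(** * The Bhattacharyya parameter under the two transforms *)

Lemma out_Z_sqr p : nonneg_pair p -> out_Z p * out_Z p = fst p * snd p.
Proof. intros [H0 H1]; apply sqrt_sqrt; nra. Qed.

Lemma out_Z_nonneg p : 0 <= out_Z p.
Proof. apply sqrt_pos. Qed.

Lemma out_Z_le_prob p : nonneg_pair p -> out_Z p <= out_prob p.
Proof.
  intros H; pose proof (out_Z_sqr p H) as E; pose proof (out_Z_nonneg p) as Pz.
  destruct H as [H0 H1]; unfold out_prob.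
  apply Rsqr_incr_0; unfold Rsqr; [rewrite E|assumption|lra].
  pose proof (Rle_0_sqr (fst p - snd p)); unfold Rsqr in *; nra.
Qed.

Lemma Zpar_nonneg V : 0 <= Zpar V.
Proof. apply sumR_map_nonneg; intros; apply out_Z_nonneg. Qed.

Lemma Zpar_le_1 V : is_BDMC V -> Zpar V <= 1.
Proof.
  intros H; rewrite <- (BDMC_out_prob V H); apply sumR_map_le.
  intros p Hp; apply out_Z_le_prob, (BDMC_nonneg V); auto.
Qed.

(** For fixed outputs [a] and [b], the two values of the extra output bit contribute equally, each
    half of [out_Z a * out_Z b]. *)
Lemma Zpar_bplus V1 V2 : is_BDMC V1 -> is_BDMC V2 -> Zpar (bplus V1 V2) = Zpar V1 * Zpar V2.
Proof.
  intros H1 H2; unfold Zpar; rewrite sum_outputs_bplus, <- sum_outputs_prod.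
  apply sum_outputs_pair_ext; intros a b Ha Hb.
  destruct (BDMC_nonneg _ _ H1 Ha), (BDMC_nonneg _ _ H2 Hb).
  assert (Hp : 0 <= fst a * snd a) by nra.
  assert (Hq : 0 <= fst b * snd b) by nra.
  assert (E : sqrt (/ 2 * / 2) = / 2) by (apply sqrt_square; lra).
  unfold out_Z; simpl.
  replace (/ 2 * (fst a * fst b) * (/ 2 * (snd a * snd b)))
    with ((/ 2 * / 2) * ((fst a * snd a) * (fst b * snd b))) by ring.
  replace (/ 2 * (snd a * fst b) * (/ 2 * (fst a * snd b)))
    with ((/ 2 * / 2) * ((fst a * snd a) * (fst b * snd b))) by ring.
  rewrite sqrt_mult_alt, E, sqrt_mult by nra; lra.
Qed.

(** The bound holds already for each pair of outputs, in the form [out_Z a * out_prob b + out_prob a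
    * out_Z b - out_Z a * out_Z b]. Summing it gives the claim because [out_prob] sums to [1]. *)
Lemma Zpar_bminus V1 V2 :
  is_BDMC V1 -> is_BDMC V2 -> Zpar (bminus V1 V2) <= Zpar V1 + Zpar V2 - Zpar V1 * Zpar V2.
Proof.
  intros H1 H2.
  replace (Zpar V1 + Zpar V2 - Zpar V1 * Zpar V2) with
    (sum_outputs (fun a => sum_outputs (fun b =>
       (out_Z a * out_prob b + out_prob a * out_Z b) + (- out_Z a) * out_Z b) V2) V1).
  2:{ assert (E : sum_outputs (fun a => - out_Z a) V1 = - Zpar V1).
      { unfold sum_outputs.
        rewrite (sumR_map_ext_in _ (fun p => -1 * out_Z p)) by (intros; ring).
        rewrite sumR_map_scal; unfold Zpar, sum_outputs; ring. }
      rewrite !sum_outputs_pair_plus, !sum_outputs_prod, !BDMC_out_prob by assumption.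
      rewrite E; unfold Zpar; ring. }
  unfold Zpar; rewrite sum_outputs_bminus.
  apply sum_outputs_pair_le; intros a b Ha Hb.
  apply (BDMC_nonneg _ _ H1) in Ha; apply (BDMC_nonneg _ _ H2) in Hb.
  pose proof (out_Z_sqr a Ha) as Ea; pose proof (out_Z_sqr b Hb) as Eb.
  pose proof (out_Z_le_prob a Ha) as La; pose proof (out_Z_le_prob b Hb) as Lb.
  pose proof (out_Z_nonneg a) as Pa; pose proof (out_Z_nonneg b) as Pb.
  unfold out_Z at 1; simpl.
  set (x := out_Z a) in *; set (y := out_Z b) in *.
  assert (Ma : out_prob a = / 2 * fst a + / 2 * snd a) by reflexivity.
  assert (Mb : out_prob b = / 2 * fst b + / 2 * snd b) by reflexivity.
  set (p := out_prob a) in *; set (q := out_prob b) in *.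
  (* The squares of the two sides differ by [2xy(p - x)(q - y)]. *)
  assert (Hr : 0 <= x * q + p * y + - x * y) by nra.
  rewrite <- (sqrt_square _ Hr); apply sqrt_le_1_alt.
  replace (/ 2 * (fst a * fst b + snd a * snd b) * (/ 2 * (snd a * fst b + fst a * snd b)))
    with ((fst a * snd a) * (q * q) + (fst b * snd b) * (p * p)
          - (fst a * snd a) * (fst b * snd b)) by (rewrite Ma, Mb; field).
  rewrite <- Ea, <- Eb.
  assert (0 <= 2 * (x * y) * ((p - x) * (q - y))).
  { repeat apply Rmult_le_pos; lra. }
  nra.
Qed.

(** * Conservation of mutual information *)

Definition eta (x : R) : R := x * ln x.

(** Since [0 * ln 0 = 0], this product rule needs no positivity. Entropy identities thus become
    polynomial identities, without the case split of [xlog]. *)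
Lemma eta_mult x y : 0 <= x -> 0 <= y -> eta (x * y) = x * eta y + y * eta x.
Proof.
  unfold eta; intros [Hx|<-] [Hy|<-]; try ring.
  rewrite ln_mult by assumption; ring.
Qed.

Lemma ln2_pos : 0 < ln 2.
Proof. rewrite <- ln_1; apply ln_increasing; lra. Qed.

Lemma ln_div x y : 0 < x -> 0 < y -> ln (x / y) = ln x - ln y.
Proof.
  intros Hx Hy; unfold Rdiv.
  rewrite ln_mult, ln_Rinv by auto using Rinv_0_lt_compat; ring.
Qed.

Lemma xlog_ln2 p a : 0 <= p -> 0 < a -> ln 2 * xlog p a = eta p - p * ln a.
Proof.
  intros Hp Ha; pose proof ln2_pos; unfold xlog, eta.
  destruct (Req_EM_T p 0) as [->|Hn]; [ring|].
  unfold log2; rewrite ln_div by lra; field; lra.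
Qed.

(** Multiplying by [ln 2] passes to natural logarithms; the two terms in [ln (out_prob p)] then
    combine into [eta (out_prob p)]. *)
Lemma out_I_eta p : nonneg_pair p ->
  ln 2 * out_I p = / 2 * eta (fst p) + / 2 * eta (snd p) - eta (out_prob p).
Proof.
  destruct p as [p q]; intros [Hp Hq]; simpl in *.
  unfold out_I, out_prob; simpl.
  destruct (Rle_lt_dec (/ 2 * p + / 2 * q) 0) as [H|H].
  - assert (p = 0) by lra; assert (q = 0) by lra; subst.
    unfold eta, xlog; destruct (Req_EM_T 0 0); [ring|lra].
  - rewrite Rmult_plus_distr_l, <- !Rmult_assoc, !(Rmult_comm (ln 2)), !Rmult_assoc.
    rewrite !xlog_ln2 by assumption; unfold eta; ring.
Qed.

(** The output probabilities of the two plus outputs are half the two entries of the minus output,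
    so their [eta] terms cancel up to multiples of [eta (/ 2)], which cancel as well. What remains
    splits by the product rule. *)
Lemma out_I_pair_conservation a b : nonneg_pair a -> nonneg_pair b ->
  out_I (/ 2 * (fst a * fst b), / 2 * (snd a * snd b)) +
  out_I (/ 2 * (snd a * fst b), / 2 * (fst a * snd b)) +
  out_I (/ 2 * (fst a * fst b + snd a * snd b),
         / 2 * (snd a * fst b + fst a * snd b)) =
  out_I a * out_prob b + out_prob a * out_I b.
Proof.
  destruct a as [a0 a1], b as [b0 b1]; intros [A0 A1] [B0 B1]; simpl in *.
  pose proof ln2_pos.
  assert (P00 := Rmult_le_pos _ _ A0 B0); assert (P11 := Rmult_le_pos _ _ A1 B1).
  assert (P10 := Rmult_le_pos _ _ A1 B0); assert (P01 := Rmult_le_pos _ _ A0 B1).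
  apply (Rmult_eq_reg_l (ln 2)); [|lra].
  rewrite !(Rmult_plus_distr_l (ln 2)).
  replace (ln 2 * (out_I (a0, a1) * out_prob (b0, b1)))
    with (ln 2 * out_I (a0, a1) * out_prob (b0, b1)) by ring.
  replace (ln 2 * (out_prob (a0, a1) * out_I (b0, b1)))
    with (out_prob (a0, a1) * (ln 2 * out_I (b0, b1))) by ring.
  rewrite !out_I_eta by (split; simpl; lra).
  unfold out_prob; simpl.
  replace (/ 2 * (/ 2 * (a0 * b0)) + / 2 * (/ 2 * (a1 * b1)))
    with (/ 2 * (/ 2 * (a0 * b0 + a1 * b1))) by ring.
  replace (/ 2 * (/ 2 * (a1 * b0)) + / 2 * (/ 2 * (a0 * b1)))
    with (/ 2 * (/ 2 * (a1 * b0 + a0 * b1))) by ring.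
  replace (/ 2 * (/ 2 * (a0 * b0 + a1 * b1)) + / 2 * (/ 2 * (a1 * b0 + a0 * b1)))
    with ((/ 2 * a0 + / 2 * a1) * (/ 2 * b0 + / 2 * b1)) by ring.
  rewrite (eta_mult (/ 2) (/ 2 * (a0 * b0 + a1 * b1))) by lra.
  rewrite (eta_mult (/ 2) (/ 2 * (a1 * b0 + a0 * b1))) by lra.
  rewrite (eta_mult (/ 2 * a0 + / 2 * a1)) by lra.
  rewrite (eta_mult (/ 2) (a0 * b0)), (eta_mult (/ 2) (a1 * b1)),
    (eta_mult (/ 2) (a1 * b0)), (eta_mult (/ 2) (a0 * b1)) by lra.
  rewrite (eta_mult a0 b0), (eta_mult a1 b1), (eta_mult a1 b0), (eta_mult a0 b1)
    by assumption.
  field.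
Qed.

Lemma I_conservation V1 V2 : is_BDMC V1 -> is_BDMC V2 ->
  I (bplus V1 V2) + I (bminus V1 V2) = I V1 + I V2.
Proof.
  intros H1 H2.
  change (sum_outputs out_I (bplus V1 V2) + sum_outputs out_I (bminus V1 V2) =
          sum_outputs out_I V1 + sum_outputs out_I V2).
  rewrite sum_outputs_bplus, sum_outputs_bminus.
  rewrite <- sum_outputs_pair_plus.
  rewrite (sum_outputs_pair_ext _
    (fun a b => out_I a * out_prob b + out_prob a * out_I b)).
  - rewrite sum_outputs_pair_plus, !sum_outputs_prod, !BDMC_out_prob by assumption; ring.
  - intros a b Ha Hb; apply out_I_pair_conservation.
    + now apply (BDMC_nonneg V1).
    + now apply (BDMC_nonneg V2).
Qed.

(** * Bounds for one channel and for one polarization step *)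

Lemma ln_le_sub1 x : 0 < x -> ln x <= x - 1.
Proof. intros H; pose proof (exp_ineq1_le (ln x)) as E; rewrite exp_ln in E; lra. Qed.

(** Both bounds are [ln t <= t - 1] multiplied by [p]: at [t = a / p] for the lower one, at
    [t = p / a] for the upper one. *)
Lemma eta_sub_bounds p a : 0 <= p -> 0 < a ->
  p - a <= eta p - p * ln a <= p * p / a - p.
Proof.
  unfold eta; intros [Hp|<-] Ha; [|unfold Rdiv; rewrite !Rmult_0_l; lra].
  assert (L1 := ln_le_sub1 (p / a) (Rdiv_lt_0_compat _ _ Hp Ha)).
  assert (L2 := ln_le_sub1 (a / p) (Rdiv_lt_0_compat _ _ Ha Hp)).
  rewrite ln_div in L1, L2 by assumption.
  apply (Rmult_le_compat_l p) in L1, L2; try lra.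
  replace (p * (a / p - 1)) with (a - p) in L2 by (field; lra).
  replace (p * (p / a - 1)) with (p * p / a - p) in L1 by (field; lra).
  split; lra.
Qed.

(* With [r = sqrt (p + q)], [x = sqrt p], [y = sqrt q]: the left-hand side is
   [2 x^2 ln (r / x) <= 2 x (r - x)], and [r <= x + y]. *)
Lemma eta_entropy_bound p q : 0 <= p -> 0 <= q -> 0 < p + q ->
  p * ln (p + q) - eta p <= 2 * sqrt (p * q).
Proof.
  unfold eta; intros [Hp|<-] Hq Hs; [|rewrite !Rmult_0_l, sqrt_0; lra].
  rewrite sqrt_mult by lra.
  assert (Ex := sqrt_sqrt p (Rlt_le _ _ Hp)).
  assert (Ey := sqrt_sqrt q Hq).
  assert (Er := sqrt_sqrt (p + q) (Rlt_le _ _ Hs)).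
  assert (Px := sqrt_lt_R0 p Hp); assert (Py := sqrt_pos q).
  assert (Pr := sqrt_lt_R0 (p + q) Hs).
  set (x := sqrt p) in *; set (y := sqrt q) in *; set (r := sqrt (p + q)) in *.
  assert (Hr : r <= x + y).
  { apply Rsqr_incr_0; unfold Rsqr; nra. }
  assert (L := ln_le_sub1 (r / x) (Rdiv_lt_0_compat _ _ Pr Px)).
  rewrite ln_div in L by assumption.
  rewrite <- Er, <- Ex, !ln_mult by assumption.
  apply (Rmult_le_compat_l (2 * (x * x))) in L; [|nra].
  replace (2 * (x * x) * (r / x - 1)) with (2 * x * (r - x)) in L by (field; lra).
  nra.
Qed.

(** These are the bounds of [I_bounds] for one output, scaled by [ln 2]. Nonnegativity and the bound
    by [out_prob p - out_Z p] use [eta_sub_bounds]; the bound on the defect [out_prob p - out_I p]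
    uses [eta_entropy_bound] for each of the two inputs. *)
Lemma out_I_bounds p : nonneg_pair p ->
  0 <= ln 2 * out_I p <= ln 2 * out_prob p /\
  ln 2 * out_I p <= 2 * (out_prob p - out_Z p) /\
  ln 2 * (out_prob p - out_I p) <= 2 * out_Z p.
Proof.
  intros H; rewrite (Rmult_minus_distr_l (ln 2)), out_I_eta by assumption.
  pose proof (out_Z_sqr p H) as E; pose proof (out_Z_nonneg p) as Pz.
  pose proof (out_Z_le_prob p H) as Lz.
  assert (Ez : out_Z p = sqrt (fst p * snd p)) by reflexivity.
  destruct p as [p q], H as [Hp Hq]; simpl in *.
  assert (Ea : out_prob (p, q) = / 2 * p + / 2 * q) by reflexivity.
  set (z := out_Z (p, q)) in *; set (a := out_prob (p, q)) in *.
  destruct (Rle_lt_dec a 0) as [Ha|Ha].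
  { assert (p = 0) by lra; assert (q = 0) by lra; assert (a = 0) by lra.
    subst p q; replace a with 0 by lra; unfold eta; repeat split; lra. }
  assert (Es : p + q = 2 * a) by lra.
  assert (Ln : ln (p + q) = ln 2 + ln a) by (rewrite Es, ln_mult; lra).
  assert (Bp := eta_sub_bounds p a Hp Ha); assert (Bq := eta_sub_bounds q a Hq Ha).
  assert (Cp := eta_entropy_bound p q Hp Hq ltac:(lra)).
  assert (Cq := eta_entropy_bound q p Hq Hp ltac:(lra)).
  rewrite (Rplus_comm q p), (Rmult_comm q p) in Cq.
  rewrite <- Ez, Ln in Cp, Cq.
  assert (Dp : forall u v, 0 <= u -> 0 <= v -> u + v = 2 * a ->
               eta u <= u * (ln 2 + ln a)).
  { intros u v [Hu|<-] Hv Huv; unfold eta; [|lra].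
    apply Rmult_le_compat_l; [lra|].
    rewrite <- ln_mult by lra.
    destruct (Rle_lt_or_eq_dec u (2 * a)) as [Hl|Hl]; [lra| |rewrite Hl; lra].
    left; apply ln_increasing; lra. }
  assert (D1 := Dp p q Hp Hq ltac:(lra)); assert (D2 := Dp q p Hq Hp ltac:(lra)).
  assert (Hea : eta a = / 2 * (p * ln a) + / 2 * (q * ln a)).
  { unfold eta; rewrite Ea at 1; ring. }
  repeat split.
  - lra.
  - assert (ln 2 * a = / 2 * (p * ln 2) + / 2 * (q * ln 2)) by (rewrite Ea; ring). nra.
  (* Here [p^2 + q^2 = (2a)^2 - 2z^2] rewrites the quadratic bound as [a - z^2 / a], and
     [z^2 / a >= 2z - a] makes it linear in [z]. *)
  - assert (Hx : p * p / a + q * q / a = 4 * a - 2 * (z * z / a)).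
    { rewrite E. field_simplify_eq; [|lra]. nra. }
    assert (Hz : 2 * z - a <= z * z / a).
    { apply (Rmult_le_reg_r a); [assumption|].
      replace (z * z / a * a) with (z * z) by (field; lra).
      pose proof (Rle_0_sqr (z - a)); unfold Rsqr in *; nra. }
    lra.
  - assert (ln 2 * a = / 2 * (p * ln 2) + / 2 * (q * ln 2)) by (rewrite Ea; ring). nra.
Qed.

Lemma sum_out_prob_minus V (f : R * R -> R) : is_BDMC V ->
  sum_outputs (fun p => out_prob p + -1 * f p) V = 1 - sum_outputs f V.
Proof.
  intros H; unfold sum_outputs; rewrite sumR_map_plus, sumR_map_scal.
  fold (sum_outputs out_prob V); rewrite BDMC_out_prob by assumption; ring.
Qed.

Lemma I_bounds V : is_BDMC V ->
  0 <= I V <= 1 /\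
  I V <= 2 / ln 2 * (1 - Zpar V) /\ 1 - I V <= 2 / ln 2 * Zpar V.
Proof.
  intros H; pose proof ln2_pos as L.
  assert (B := fun p Hp => out_I_bounds p (BDMC_nonneg V p H Hp)).
  change (I V) with (sum_outputs out_I V); unfold Zpar.
  rewrite <- (sum_out_prob_minus V out_Z), <- (sum_out_prob_minus V out_I) by assumption.
  rewrite <- (BDMC_out_prob V H).
  unfold sum_outputs; rewrite <- !sumR_map_scal.
  repeat split.
  - apply sumR_map_nonneg; intros p Hp; specialize (B p Hp); nra.
  - apply sumR_map_le; intros p Hp; specialize (B p Hp); nra.
  - apply sumR_map_le; intros p Hp; specialize (B p Hp).
    apply (Rmult_le_reg_l (ln 2)); [assumption|].
    replace (ln 2 * (2 / ln 2 * (out_prob p + -1 * out_Z p)))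
      with (2 * (out_prob p - out_Z p)) by (field; lra); lra.
  - apply sumR_map_le; intros p Hp; specialize (B p Hp).
    apply (Rmult_le_reg_l (ln 2)); [assumption|].
    replace (ln 2 * (2 / ln 2 * out_Z p)) with (2 * out_Z p) by (field; lra); lra.
Qed.

(** With [x] and [y] the two parameters, [(1 + xy)(1 + x + y - xy)] equals
    [(1 + x)(1 + y) - x(1 - x)y(1 - y)] exactly. Then [ln t <= t - 1] is applied to the ratio of the
    products, and the [4] bounds [(1 + x)(1 + y)]. *)
Lemma ln_1_plus_Z_step V1 V2 : is_BDMC V1 -> is_BDMC V2 ->
  ln (1 + Zpar (bplus V1 V2)) + ln (1 + Zpar (bminus V1 V2)) <=
  ln (1 + Zpar V1) + ln (1 + Zpar V2) - Zpar V1 * (1 - Zpar V1) * (Zpar V2 * (1 - Zpar V2)) / 4.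
Proof.
  intros H1 H2.
  rewrite Zpar_bplus by assumption; pose proof (Zpar_bminus V1 V2 H1 H2) as Hm.
  pose proof (Zpar_nonneg V1); pose proof (Zpar_nonneg V2).
  pose proof (Zpar_nonneg (bminus V1 V2)).
  pose proof (Zpar_le_1 V1 H1); pose proof (Zpar_le_1 V2 H2).
  set (x := Zpar V1) in *; set (y := Zpar V2) in *; set (w := Zpar (bminus V1 V2)) in *.
  assert (Hxy : 0 <= x * y) by nra.
  rewrite <- !ln_mult by lra.
  set (A := (1 + x) * (1 + y)); set (G := x * (1 - x) * (y * (1 - y))).
  assert (HG : 0 <= G) by (unfold G; repeat apply Rmult_le_pos; lra).
  assert (HA : 0 < A <= 4) by (unfold A; nra).
  assert (HB : 0 < (1 + x * y) * (1 + w)) by nra.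
  assert (HAB : (1 + x * y) * (1 + w) <= A - G).
  { apply Rle_trans with ((1 + x * y) * (1 + (x + y - x * y))); [nra|].
    unfold A, G; lra. }
  assert (L := ln_le_sub1 ((1 + x * y) * (1 + w) / A)
                 (Rdiv_lt_0_compat _ _ HB (proj1 HA))).
  rewrite ln_div in L by lra.
  assert ((1 + x * y) * (1 + w) / A - 1 <= - G / 4); [|lra].
  apply (Rmult_le_reg_r A); [lra|].
  replace (((1 + x * y) * (1 + w) / A - 1) * A)
    with ((1 + x * y) * (1 + w) - A) by (field; lra).
  nra.
Qed.

(** * The counting function and the state vectors *)

Lemma N_aux_fuel m f n : (1 <= m)%nat -> (n <= f)%nat -> N_aux m f n = Ncount m n.
Proof.
  intros Hm; unfold Ncount.
  assert (H : forall f g n, (n <= f)%nat -> (n <= g)%nat -> N_aux m f n = N_aux m g n).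
  { clear f n; induction f as [|f IH]; intros [|g] [|n] Hf Hg; try lia; try reflexivity.
    cbn [N_aux]; f_equal; apply IH; lia. }
  intros Hn; apply H; lia.
Qed.

Lemma Ncount_S m n : (1 <= m)%nat ->
  Ncount m (S n) = (Ncount m n + Ncount m (S n - m))%nat.
Proof.
  intros Hm; unfold Ncount at 1; cbn [N_aux].
  rewrite !(N_aux_fuel m n) by lia; reflexivity.
Qed.

Lemma Ncount_mono m n p : (1 <= m)%nat -> (n <= p)%nat -> (Ncount m n <= Ncount m p)%nat.
Proof.
  intros Hm Hnp; induction Hnp as [|p _ IH]; [lia|].
  rewrite Ncount_S by assumption; lia.
Qed.

Lemma Ncount_pos m n : (1 <= m)%nat -> (1 <= Ncount m n)%nat.
Proof. intros Hm; apply (Ncount_mono m 0 n Hm); lia. Qed.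

(** Each [m] steps at least double the count: [N(n + m) = N(n + m - 1) + N(n)], and both terms are
    at least [N(n)]. *)
Lemma Ncount_double m n B : (1 <= m)%nat -> (2 ^ B * Ncount m n <= Ncount m (n + m * B))%nat.
Proof.
  intros Hm; induction B as [|B IH].
  - rewrite Nat.mul_0_r, Nat.add_0_r; simpl; lia.
  - replace (n + m * S B)%nat with (S (n + m * B + (m - 1))) by lia.
    rewrite Ncount_S by assumption.
    replace (S (n + m * B + (m - 1)) - m)%nat with (n + m * B)%nat by lia.
    pose proof (Ncount_mono m (n + m * B) (n + m * B + (m - 1)) Hm ltac:(lia)).
    rewrite Nat.pow_succ_r'; lia.
Qed.

Lemma length_Slist m n : (1 <= m)%nat -> length (Slist m n) = Ncount m n.
Proof.
  intros Hm; induction n as [|n IH]; [reflexivity|].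
  rewrite Ncount_S by assumption.
  pose proof (Ncount_mono m (S n - m) n Hm ltac:(lia)).
  cbn [Slist]; cbv zeta.
  rewrite !length_app, !length_map, length_skipn, length_firstn, IH; lia.
Qed.

(** Indices are shifted to start at [0]: this is the vector with number [j + 1], and the default
    [[]] is only returned beyond the [Ncount m n] states. *)
Definition state (m n j : nat) : list sign := nth j (Slist m n) [].

Lemma nth_map_firstn {A B} (f : A -> B) l k j d e : (j < k)%nat -> (j < length l)%nat ->
  nth j (map f (firstn k l)) e = f (nth j l d).
Proof.
  intros Hk Hl; rewrite (nth_indep _ e (f d)) by (rewrite length_map, length_firstn; lia).
  rewrite map_nth, nth_firstn.
  now replace (j <? k)%nat with true by (symmetry; now apply Nat.ltb_lt).
Qed.

Lemma state_plus m n j : (1 <= m)%nat -> (j < Ncount m (S n - m))%nat ->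
  state m (S n) j = state m n j ++ [Plus].
Proof.
  intros Hm Hj; unfold state; cbn [Slist]; cbv zeta.
  pose proof (Ncount_mono m (S n - m) n Hm ltac:(lia)).
  pose proof (length_Slist m n Hm).
  rewrite app_nth1 by (rewrite length_map, length_firstn; lia).
  now apply (nth_map_firstn (fun s => s ++ [Plus])); [|lia].
Qed.

Lemma state_minus m n j : (1 <= m)%nat -> (j < Ncount m (S n - m))%nat ->
  state m (S n) (Ncount m n + j) = state m n j ++ [Minus].
Proof.
  intros Hm Hj; unfold state; cbn [Slist]; cbv zeta.
  pose proof (Ncount_mono m (S n - m) n Hm ltac:(lia)).
  pose proof (length_Slist m n Hm).
  rewrite app_assoc, app_nth2;
    rewrite length_app, !length_map, length_skipn, length_firstn; [|lia].
  replace (Ncount m n + j - _)%nat with j by lia.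
  now apply (nth_map_firstn (fun s => s ++ [Minus])); [|lia].
Qed.

Lemma state_star m n j : (1 <= m)%nat -> (Ncount m (S n - m) <= j < Ncount m n)%nat ->
  state m (S n) j = state m n j ++ [Star].
Proof.
  intros Hm Hj; unfold state; cbn [Slist]; cbv zeta.
  pose proof (Ncount_mono m (S n - m) n Hm ltac:(lia)).
  pose proof (length_Slist m n Hm).
  rewrite app_nth2; rewrite length_map, length_firstn; [|lia].
  rewrite app_nth1 by (rewrite length_map, length_skipn; lia).
  rewrite (nth_indep _ [] ([] ++ [Star])) by (rewrite length_map, length_skipn; lia).
  rewrite (map_nth (fun s => s ++ [Star])), nth_skipn.
  do 2 f_equal; lia.
Qed.

Lemma length_state m n j : (1 <= m)%nat -> (j < Ncount m n)%nat -> length (state m n j) = n.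
Proof.
  intros Hm; revert j; induction n as [|n IH]; intros j Hj.
  - change (Ncount m 0) with 1%nat in Hj; now replace j with 0%nat by lia.
  - pose proof (Ncount_mono m (S n - m) n Hm ltac:(lia)).
    destruct (lt_dec j (Ncount m (S n - m))) as [H1|H1].
    { rewrite state_plus, length_app, IH by lia; simpl; lia. }
    destruct (lt_dec j (Ncount m n)) as [H2|H2].
    { rewrite state_star, length_app, IH by lia; simpl; lia. }
    rewrite Ncount_S in Hj by assumption.
    replace j with (Ncount m n + (j - Ncount m n))%nat by lia.
    rewrite state_minus, length_app, IH by lia; simpl; lia.
Qed.

(** Plus and idle steps keep the index and append one sign; only minus steps create new indices.
    Hence the truncated string in the recursion for [Wt] is the state of the same index at the
    earlier time. *)
Lemma firstn_state m k n j : (1 <= m)%nat -> (k <= n)%nat -> (j < Ncount m k)%nat ->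
  firstn k (state m n j) = state m k j.
Proof.
  intros Hm Hkn Hj; induction Hkn as [|n Hkn IH].
  - rewrite <- (length_state m k j Hm Hj) at 1; apply firstn_all.
  - pose proof (Ncount_mono m k n Hm Hkn).
    assert (E : exists x, state m (S n) j = state m n j ++ [x]).
    { destruct (lt_dec j (Ncount m (S n - m))).
      - exists Plus; now apply state_plus.
      - exists Star; apply state_star; lia. }
    destruct E as [x ->].
    rewrite firstn_app, length_state by lia.
    replace (k - n)%nat with 0%nat by lia; rewrite IH; apply app_nil_r.
Qed.

(** * Channels attached to the states *)

Lemma Wt_aux_fuel m W f t : (1 <= m)%nat -> (length t <= f)%nat -> Wt_aux m W f t = Wt m W t.
Proof.
  intros Hm; unfold Wt.
  assert (H : forall f g t, (length t <= f)%nat -> (length t <= g)%nat ->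
                Wt_aux m W f t = Wt_aux m W g t).
  { clear f t; induction f as [|f IH]; intros [|g] t Hf Hg; try reflexivity.
    - assert (t = []) as -> by (apply length_zero_iff_nil; lia); reflexivity.
    - assert (t = []) as -> by (apply length_zero_iff_nil; lia); reflexivity.
    - destruct t as [|x t _] using rev_ind; [reflexivity|].
      rewrite length_app in Hf, Hg; simpl in Hf, Hg.
      cbn [Wt_aux]; rewrite rev_unit; cbv beta iota zeta; rewrite rev_involutive.
      rewrite (IH g t), (IH g (firstn _ _));
        try (rewrite length_firstn, length_app; simpl; lia); try lia.
      reflexivity. }
  intros Hf; apply H; lia.
Qed.

(** Since [m >= 1], the prefix of length [S (length t) - m] of [t ++ [x]] does not reach [x], so it
    can be taken in [t]. *)
Lemma Wt_snoc m W t x : (1 <= m)%nat ->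
  Wt m W (t ++ [x]) =
  match x with
  | Plus => bplus (Wt m W (firstn (S (length t) - m) t)) (Wt m W t)
  | Minus => bminus (Wt m W (firstn (S (length t) - m) t)) (Wt m W t)
  | Star => Wt m W t
  end.
Proof.
  intros Hm; unfold Wt at 1.
  rewrite length_app, Nat.add_1_r; cbn [Wt_aux].
  rewrite rev_unit; cbv beta iota zeta; rewrite rev_involutive.
  rewrite length_app, Nat.add_1_r, firstn_app.
  replace (S (length t) - m - length t)%nat with 0%nat by lia.
  rewrite app_nil_r.
  rewrite !Wt_aux_fuel by (try rewrite length_firstn; lia); reflexivity.
Qed.

Lemma Wt_BDMC m W t : is_BDMC W -> is_BDMC (Wt m W t).
Proof.
  intros HW; unfold Wt; generalize (length t) as f; intros f; revert t.
  induction f as [|f IH]; intros t; [assumption|]; cbn [Wt_aux].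
  destruct (rev t) as [|[] r]; auto using bplus_BDMC, bminus_BDMC.
Qed.

Definition bit_channel m W n j : channel := Wt m W (state m n j).

Lemma bit_channel_BDMC m W n j : is_BDMC W -> is_BDMC (bit_channel m W n j).
Proof. apply Wt_BDMC. Qed.

Lemma bit_channel_plus m W n j : (1 <= m)%nat -> (j < Ncount m (S n - m))%nat ->
  bit_channel m W (S n) j = bplus (bit_channel m W (S n - m) j) (bit_channel m W n j).
Proof.
  intros Hm Hj; unfold bit_channel.
  pose proof (Ncount_mono m (S n - m) n Hm ltac:(lia)).
  rewrite state_plus, Wt_snoc, length_state, firstn_state by lia; reflexivity.
Qed.

Lemma bit_channel_minus m W n j : (1 <= m)%nat -> (j < Ncount m (S n - m))%nat ->
  bit_channel m W (S n) (Ncount m n + j) =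
  bminus (bit_channel m W (S n - m) j) (bit_channel m W n j).
Proof.
  intros Hm Hj; unfold bit_channel.
  pose proof (Ncount_mono m (S n - m) n Hm ltac:(lia)).
  rewrite state_minus, Wt_snoc, length_state, firstn_state by lia; reflexivity.
Qed.

Lemma bit_channel_star m W n j : (1 <= m)%nat -> (Ncount m (S n - m) <= j < Ncount m n)%nat ->
  bit_channel m W (S n) j = bit_channel m W n j.
Proof.
  intros Hm Hj; unfold bit_channel.
  rewrite state_star, Wt_snoc by assumption; reflexivity.
Qed.

(** * Sums over index ranges and totals over all states *)

Definition sum_range (f : nat -> R) (a b : nat) : R := sumR (map f (seq a (b - a))).

Lemma in_range a b j : In j (seq a (b - a)) -> (a <= j < b)%nat.
Proof. intros H; apply in_seq in H; lia. Qed.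

Lemma sum_range_split f a b c : (a <= b <= c)%nat ->
  sum_range f a c = sum_range f a b + sum_range f b c.
Proof.
  intros H; unfold sum_range.
  replace (c - a)%nat with ((b - a) + (c - b))%nat by lia.
  rewrite seq_app, map_app, sumR_app.
  now replace (a + (b - a))%nat with b by lia.
Qed.

Lemma sum_range_shift f a b :
  sum_range f a (a + b) = sum_range (fun j => f (a + j)%nat) 0 b.
Proof.
  unfold sum_range; rewrite Nat.sub_0_r, Nat.add_comm, Nat.add_sub.
  rewrite <- (Nat.add_0_r a) at 1.
  generalize 0%nat as s; induction b as [|b IH]; intros s; [reflexivity|].
  simpl; f_equal; rewrite <- IH, Nat.add_succ_r; reflexivity.
Qed.

Lemma sum_range_ext f g a b :
  (forall j, (a <= j < b)%nat -> f j = g j) -> sum_range f a b = sum_range g a b.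
Proof. intros H; apply sumR_map_ext_in; intros j Hj; apply H, in_range, Hj. Qed.

Lemma sum_range_le f g a b :
  (forall j, (a <= j < b)%nat -> f j <= g j) -> sum_range f a b <= sum_range g a b.
Proof. intros H; apply sumR_map_le; intros j Hj; apply H, in_range, Hj. Qed.

Lemma sum_range_nonneg f a b :
  (forall j, (a <= j < b)%nat -> 0 <= f j) -> 0 <= sum_range f a b.
Proof. intros H; apply sumR_map_nonneg; intros j Hj; apply H, in_range, Hj. Qed.

Lemma sum_range_const c a b : (a <= b)%nat -> sum_range (fun _ => c) a b = (INR b - INR a) * c.
Proof.
  intros H; unfold sum_range; rewrite sumR_map_const, length_seq, minus_INR by assumption.
  reflexivity.
Qed.

Lemma sum_range_plus f g a b :
  sum_range (fun j => f j + g j) a b = sum_range f a b + sum_range g a b.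
Proof. apply sumR_map_plus. Qed.

Lemma sum_range_scal c f a b : sum_range (fun j => c * f j) a b = c * sum_range f a b.
Proof. apply sumR_map_scal. Qed.

Definition total (m : nat) (W : channel) (F : channel -> R) (n : nat) : R :=
  sum_range (fun j => F (bit_channel m W n j)) 0 (Ncount m n).

Lemma map_nth_seq {A} (l : list A) d : map (fun j => nth j l d) (seq 0 (length l)) = l.
Proof.
  induction l as [|x l IH]; [reflexivity|].
  cbn [length seq map nth]; f_equal.
  rewrite <- seq_shift, map_map; exact IH.
Qed.

Lemma total_Slist m W F n : (1 <= m)%nat ->
  sumR (map (fun s => F (Wt m W s)) (Slist m n)) = total m W F n.
Proof.
  intros Hm; unfold total, sum_range, bit_channel, state.
  rewrite Nat.sub_0_r, <- (length_Slist m n Hm).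
  generalize (Slist m n) as l; intros l; f_equal.
  rewrite <- (map_map (fun j => nth j l []) (fun s => F (Wt m W s))).
  f_equal; now rewrite map_nth_seq.
Qed.

(** Indices below [Ncount m (S n - m)] take a plus step, the remaining old ones idle, and those from
    [Ncount m n] on are the minus children. Shifting the last range pairs each minus channel with
    its plus sibling. *)
Lemma total_step m W F n : (1 <= m)%nat ->
  total m W F (S n) =
  sum_range (fun j =>
    F (bplus (bit_channel m W (S n - m) j) (bit_channel m W n j)) +
    F (bminus (bit_channel m W (S n - m) j) (bit_channel m W n j)))
    0 (Ncount m (S n - m)) +
  sum_range (fun j => F (bit_channel m W n j)) (Ncount m (S n - m)) (Ncount m n).
Proof.
  intros Hm; unfold total.
  pose proof (Ncount_mono m (S n - m) n Hm ltac:(lia)).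
  rewrite Ncount_S by assumption.
  rewrite (sum_range_split _ 0 (Ncount m n)) by lia.
  rewrite (sum_range_split _ 0 (Ncount m (S n - m)) (Ncount m n)) by lia.
  rewrite sum_range_shift, sum_range_plus.
  rewrite (sum_range_ext _ _ 0 (Ncount m (S n - m)) (fun j Hj =>
    f_equal F (bit_channel_plus m W n j Hm (proj2 Hj)))).
  rewrite (sum_range_ext _ _ (Ncount m (S n - m)) (Ncount m n) (fun j Hj =>
    f_equal F (bit_channel_star m W n j Hm Hj))).
  rewrite (sum_range_ext _ _ 0 (Ncount m (S n - m)) (fun j Hj =>
    f_equal F (bit_channel_minus m W n j Hm (proj2 Hj)))).
  ring.
Qed.

(** Written over the same ranges as [total_step], so that a relation for one pair of channels passes
    to the totals term by term. *)
Lemma total_split m W F n : (1 <= m)%nat ->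
  total m W F n + total m W F (S n - m) =
  sum_range (fun j => F (bit_channel m W (S n - m) j) + F (bit_channel m W n j))
    0 (Ncount m (S n - m)) +
  sum_range (fun j => F (bit_channel m W n j)) (Ncount m (S n - m)) (Ncount m n).
Proof.
  intros Hm; unfold total.
  pose proof (Ncount_mono m (S n - m) n Hm ltac:(lia)).
  rewrite (sum_range_split _ 0 (Ncount m (S n - m)) (Ncount m n)) by lia.
  rewrite sum_range_plus; ring.
Qed.

(** By conservation the total of [I] obeys the recurrence of [N], starting from [I W]. *)
Lemma total_I m W n : (1 <= m)%nat -> is_BDMC W ->
  total m W I n = INR (Ncount m n) * I W.
Proof.
  intros Hm HW; induction n as [n IH] using lt_wf_ind; destruct n as [|n].
  - unfold total, sum_range, bit_channel, state, Wt; simpl; ring.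
  - rewrite total_step by assumption.
    rewrite Ncount_S, plus_INR, Rmult_plus_distr_r by assumption.
    rewrite <- !IH, total_split by lia.
    f_equal; apply sum_range_ext; intros j _.
    apply I_conservation; now apply bit_channel_BDMC.
Qed.

(** * Indices followed from their creation *)

Definition spread (V : channel) : R := Zpar V * (1 - Zpar V).

Lemma spread_bounds V : is_BDMC V -> 0 <= spread V <= 1.
Proof. intros H; pose proof (Zpar_nonneg V); pose proof (Zpar_le_1 V H); unfold spread; nra. Qed.

(* The indices [j] with [Ncount m (pred k) <= j < Ncount m k] are those created
   at time [k], by a minus step; the range is empty for [k = 0]. *)
Definition newborn_total (m : nat) (W : channel) (F : channel -> R) (k : nat) : R :=
  sum_range (fun j => F (bit_channel m W k j)) (Ncount m (pred k)) (Ncount m k).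

(** Up to time [k + m - 1], only indices below [Ncount m (pred k)] are combined. *)
Lemma newborn_idle m W k i j : (1 <= m)%nat -> (i < m)%nat ->
  (Ncount m (pred k) <= j < Ncount m k)%nat ->
  bit_channel m W (k + i) j = bit_channel m W k j.
Proof.
  intros Hm Hi Hj; induction i as [|i IH]; [now rewrite Nat.add_0_r|].
  rewrite Nat.add_succ_r, bit_channel_star; [apply IH; lia|assumption|].
  pose proof (Ncount_mono m (S (k + i) - m) (pred k) Hm ltac:(lia)).
  pose proof (Ncount_mono m k (k + i) Hm ltac:(lia)); lia.
Qed.

(** A plus step gives [u * v], with both factors bounded by the parameter at birth, and
    [1 - u * v <= (1 - u) + (1 - v)] at most doubles the bound on the distance to [1]. The induction
    is strong because one factor comes from an earlier time. *)
Lemma newborn_Z_decay m W k a j : (1 <= m)%nat -> is_BDMC W ->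
  (Ncount m (pred k) <= j < Ncount m k)%nat ->
  Zpar (bit_channel m W (k + a) j) <= Zpar (bit_channel m W k j) /\
  1 - Zpar (bit_channel m W (k + a) j) <= 2 ^ a * (1 - Zpar (bit_channel m W k j)).
Proof.
  intros Hm HW Hj.
  assert (B : forall n, 0 <= Zpar (bit_channel m W n j) <= 1).
  { intros n; split; [apply Zpar_nonneg|apply Zpar_le_1, bit_channel_BDMC, HW]. }
  induction a as [a IH] using lt_wf_ind; destruct a as [|a].
  { rewrite Nat.add_0_r; simpl; lra. }
  assert (P : 0 < 2 ^ a) by (apply pow_lt; lra).
  pose proof (IH a ltac:(lia)) as [IH1 IH2].
  pose proof (B k) as Bk; pose proof (B (k + a)%nat) as Ba.
  rewrite Nat.add_succ_r; change (2 ^ S a) with (2 * 2 ^ a).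
  destruct (lt_dec j (Ncount m (S (k + a) - m))) as [Hp|Hp].
  (* The delayed factor is not older than the index: before time [k] the count is at most
     [Ncount m (pred k) <= j]. *)
  - assert (Hk : (k <= S (k + a) - m)%nat).
    { destruct (le_lt_dec k (S (k + a) - m)) as [|H]; [assumption|].
      pose proof (Ncount_mono m (S (k + a) - m) (pred k) Hm ltac:(lia)); lia. }
    rewrite bit_channel_plus, Zpar_bplus by (auto using bit_channel_BDMC).
    assert (E : exists b, (b <= a)%nat /\ (S (k + a) - m)%nat = (k + b)%nat).
    { exists (S (k + a) - m - k)%nat; lia. }
    destruct E as [b [Hb ->]].
    pose proof (IH b ltac:(lia)) as [IHb1 IHb2]; pose proof (B (k + b)%nat) as Bb.
    assert (2 ^ b <= 2 ^ a) by (apply Rle_pow; lra || lia).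
    split; nra.
  - rewrite bit_channel_star; [split; nra|assumption|].
    pose proof (Ncount_mono m k (k + a) Hm ltac:(lia)); lia.
Qed.

Lemma newborn_spread_growth m W k a j : (1 <= m)%nat -> is_BDMC W ->
  (Ncount m (pred k) <= j < Ncount m k)%nat ->
  spread (bit_channel m W (k + a) j) <= 2 ^ a * spread (bit_channel m W k j).
Proof.
  intros Hm HW Hj; destruct (newborn_Z_decay m W k a j Hm HW Hj) as [H1 H2].
  pose proof (Zpar_nonneg (bit_channel m W (k + a) j)).
  pose proof (Zpar_le_1 (bit_channel m W (k + a) j) (bit_channel_BDMC _ _ _ _ HW)).
  unfold spread.
  apply Rle_trans with (Zpar (bit_channel m W k j) * (1 - Zpar (bit_channel m W (k + a) j)));
    nra.
Qed.

(** * The logarithmic total and its loss *)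

Definition ln_1_plus_Z (V : channel) : R := ln (1 + Zpar V).

Definition spread_sqr (V : channel) : R := spread V * spread V.

(** At time [k + m] the partners come from times [k] and [k + m - 1]. For indices created at time
    [k] the two channels coincide by [newborn_idle], so the product of spreads is a square; the
    losses of older indices are nonnegative and dropped. *)
Lemma total_ln_step m W k : (1 <= m)%nat -> is_BDMC W ->
  total m W ln_1_plus_Z (k + m) <=
  total m W ln_1_plus_Z (k + (m - 1)) + total m W ln_1_plus_Z k
  - newborn_total m W spread_sqr k / 4.
Proof.
  intros Hm HW.
  assert (E : (S (k + (m - 1)) - m)%nat = k) by lia.
  replace (k + m)%nat with (S (k + (m - 1))) by lia.
  pose proof (total_split m W ln_1_plus_Z (k + (m - 1)) Hm) as Hs.
  rewrite total_step by assumption; rewrite E in *; rewrite Hs.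
  set (n := (k + (m - 1))%nat) in *.
  apply Rle_trans with (sum_range (fun j =>
      (ln_1_plus_Z (bit_channel m W k j) + ln_1_plus_Z (bit_channel m W n j)) +
      - / 4 * (spread (bit_channel m W k j) * spread (bit_channel m W n j)))
      0 (Ncount m k) +
    sum_range (fun j => ln_1_plus_Z (bit_channel m W n j)) (Ncount m k) (Ncount m n)).
  - apply Rplus_le_compat_r, sum_range_le; intros j _.
    pose proof (ln_1_plus_Z_step (bit_channel m W k j) (bit_channel m W n j)
      (bit_channel_BDMC _ _ _ _ HW) (bit_channel_BDMC _ _ _ _ HW)).
    unfold ln_1_plus_Z, spread; lra.
  - rewrite sum_range_plus, sum_range_scal.
    rewrite (sum_range_split (fun j => spread _ * _) 0 (Ncount m (pred k)))
      by (split; [lia|apply Ncount_mono; lia]).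
    assert (H0 : 0 <= sum_range (fun j =>
      spread (bit_channel m W k j) * spread (bit_channel m W n j)) 0 (Ncount m (pred k))).
    { apply sum_range_nonneg; intros j _; apply Rmult_le_pos;
        apply spread_bounds, bit_channel_BDMC, HW. }
    unfold newborn_total.
    rewrite <- (sum_range_ext (fun j =>
      spread (bit_channel m W k j) * spread (bit_channel m W n j))
      (fun j => spread_sqr (bit_channel m W k j))); [lra|].
    intros j Hj; unfold n, spread_sqr; rewrite newborn_idle by (assumption || lia).
    reflexivity.
Qed.

(** The inverse of [x] is the positive root of the characteristic equation [y^m = y^(m-1) + 1] of
    the recurrence of [N]. *)
Lemma growth_root m : (1 <= m)%nat -> exists x, 0 < x < 1 /\ x + x ^ m = 1.
Proof.
  intros Hm.
  assert (C : continuity (fun x => x + x ^ m - 1)).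
  { apply derivable_continuous; apply derivable_minus; [|apply derivable_const].
    apply derivable_plus; [apply derivable_id|apply derivable_pow]. }
  assert (E0 : 0 ^ m = 0) by (apply pow_ne_zero; lia).
  assert (E1 : 1 ^ m = 1) by apply pow1.
  destruct (IVT _ 0 1 C) as [x [Hx Hf]]; [lra|lra|lra|].
  exists x; split; [|lra].
  split.
  - destruct (Rle_lt_or_eq_dec 0 x) as [|<-]; lra.
  - destruct (Rle_lt_or_eq_dec x 1) as [| ->]; lra.
Qed.

(** This lower bound on [N] converts smallness of a sequence weighted by [x ^ k] into smallness
    relative to [Ncount m k]. *)
Lemma Ncount_growth m x n : (1 <= m)%nat -> 0 < x < 1 -> x + x ^ m = 1 ->
  1 <= x ^ n * INR (Ncount m n).
Proof.
  intros Hm Hx E; induction n as [n IH] using lt_wf_ind; destruct n as [|n].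
  { simpl; lra. }
  rewrite Ncount_S, plus_INR by assumption.
  pose proof (IH n ltac:(lia)) as IH1.
  assert (IH2 : x ^ m <= x ^ S n * INR (Ncount m (S n - m))).
  { destruct (le_lt_dec m (S n)) as [H|H].
    - pose proof (IH (S n - m)%nat ltac:(lia)) as IH2.
      replace (S n) with (m + (S n - m))%nat at 1 by lia.
      rewrite pow_add; pose proof (pow_lt x m (proj1 Hx)); nra.
    (* While [S n < m] the delayed count is [1], and [x ^ m <= x ^ S n] because [x < 1]. *)
    - replace (S n - m)%nat with 0%nat by lia.
      change (INR (Ncount m 0)) with 1; rewrite Rmult_1_r.
      replace m with (S n + (m - S n))%nat by lia; rewrite pow_add.
      pose proof (pow_lt x (S n) (proj1 Hx)).
      pose proof (pow_incr x 1 (m - S n) ltac:(lra)) as Hp; rewrite pow1 in Hp; nra. }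
  change (x ^ S n) with (x * x ^ n) in *; nra.
Qed.

Lemma INR_Ncount_pos m n : (1 <= m)%nat -> 0 < INR (Ncount m n).
Proof. intros Hm; apply lt_0_INR; pose proof (Ncount_pos m n Hm); lia. Qed.

Lemma total_nonneg m W F n : is_BDMC W -> (forall V, is_BDMC V -> 0 <= F V) ->
  0 <= total m W F n.
Proof. intros HW H; apply sum_range_nonneg; intros; apply H, bit_channel_BDMC, HW. Qed.

Lemma newborn_total_nonneg m W F n : is_BDMC W -> (forall V, is_BDMC V -> 0 <= F V) ->
  0 <= newborn_total m W F n.
Proof. intros HW H; apply sum_range_nonneg; intros; apply H, bit_channel_BDMC, HW. Qed.

Lemma decreasing_increments_cv0 (E : nat -> R) :
  (forall k, 0 <= E k) -> (forall k, E (S k) <= E k) -> Un_cv (fun k => E k - E (S k)) 0.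
Proof.
  intros H0 Hd.
  assert (D : Un_decreasing E) by exact Hd.
  assert (B : has_lb E).
  { exists 0; intros y [k ->]; unfold opp_seq; specialize (H0 k); lra. }
  destruct (decreasing_cv E D B) as [l Hl].
  intros e He; destruct (Hl (e / 2) ltac:(lra)) as [n0 Hn].
  exists n0; intros n Hge.
  pose proof (Hn n Hge) as A1; pose proof (Hn (S n) ltac:(lia)) as A2.
  unfold Rdist in *; rewrite Rminus_0_r.
  apply Rabs_def2 in A1; apply Rabs_def2 in A2; apply Rabs_def1; lra.
Qed.

(* With [t k = x ^ k * T k], the Lyapunov function is
   [t (k + (m - 1)) + x ^ m * (t k + ... + t (k + (m - 2)))]. *)
Lemma delayed_recurrence_loss_cv0 m x (T D : nat -> R) :
  (1 <= m)%nat -> 0 < x -> x + x ^ m = 1 ->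
  (forall k, 0 <= T k) -> (forall k, 0 <= D k) ->
  (forall k, T (k + m)%nat <= T (k + (m - 1))%nat + T k - D k) ->
  Un_cv (fun k => x ^ k * D k) 0.
Proof.
  intros Hm Hx Ex HT HD Hrec.
  pose proof (pow_lt x m Hx) as Pm.
  set (E := fun k => x ^ (k + (m - 1)) * T (k + (m - 1))%nat +
              x ^ m * sum_range (fun i => x ^ i * T i) k (k + (m - 1))).
  assert (Pt : forall k, 0 <= x ^ k * T k).
  { intros k; apply Rmult_le_pos; [apply pow_le; lra|apply HT]. }
  assert (E0 : forall k, 0 <= E k).
  { intros k; unfold E; pose proof (Pt (k + (m - 1))%nat).
    assert (0 <= sum_range (fun i => x ^ i * T i) k (k + (m - 1)))
      by (apply sum_range_nonneg; intros; apply Pt).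
    nra. }
  assert (sum_one : forall f k, sum_range f k (S k) = f k).
  { intros f k; unfold sum_range; replace (S k - k)%nat with 1%nat by lia; simpl; lra. }
  assert (Ed : forall k, x ^ m * (x ^ k * D k) <= E k - E (S k)).
  { intros k; unfold E.
    assert (Hs : sum_range (fun i => x ^ i * T i) (S k) (S k + (m - 1)) =
      sum_range (fun i => x ^ i * T i) k (k + (m - 1))
      + x ^ (k + (m - 1)) * T (k + (m - 1))%nat - x ^ k * T k).
    { pose proof (sum_range_split (fun i => x ^ i * T i) k (S k) (S k + (m - 1)) ltac:(lia)) as S1.
      pose proof (sum_range_split (fun i => x ^ i * T i) k (k + (m - 1)) (S (k + (m - 1)))
        ltac:(lia)) as S2.
      rewrite sum_one in S1, S2; change (S k + (m - 1))%nat with (S (k + (m - 1))) in *; lra. }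
    rewrite Hs; clear Hs.
    replace (S k + (m - 1))%nat with (k + m)%nat by lia.
    pose proof (Rmult_le_compat_l _ _ _ (Rlt_le _ _ (pow_lt x (k + m) Hx)) (Hrec k)) as Hr.
    assert (Q1 : x ^ (k + m) = x * x ^ (k + (m - 1))).
    { replace (k + m)%nat with (S (k + (m - 1))) by lia; reflexivity. }
    assert (Q2 : x ^ (k + m) = x ^ k * x ^ m) by apply pow_add.
    assert (Hr' : x ^ (k + m) * T (k + m)%nat <=
      x * (x ^ (k + (m - 1)) * T (k + (m - 1))%nat) + x ^ m * (x ^ k * T k)
      - x ^ m * (x ^ k * D k)).
    { apply (Rle_trans _ _ _ Hr); right.
      rewrite Rmult_minus_distr_l, Rmult_plus_distr_l, Q1 at 1; rewrite Q2; ring. }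
    (* Of the coefficient [1 - x ^ m], the [1] matches the leading term of [E k], and the rest pays
       for the term entering the window sum. *)
    replace x with (1 - x ^ m) in Hr' at 2 by lra.
    clear - Hr'; lra. }
  assert (Em : forall k, E (S k) <= E k).
  { intros k; specialize (Ed k); specialize (HD k).
    pose proof (pow_lt x k Hx).
    assert (0 <= x ^ m * (x ^ k * D k)) by (repeat apply Rmult_le_pos; lra).
    lra. }
  intros e He.
  destruct (decreasing_increments_cv0 E E0 Em (x ^ m * e)) as [n0 Hn]; [nra|].
  exists n0; intros k Hk; specialize (Hn k Hk); specialize (Ed k).
  unfold Rdist in *; rewrite Rminus_0_r in *.
  pose proof (pow_le x k ltac:(lra)); pose proof (HD k).
  rewrite Rabs_pos_eq by nra.
  apply Rabs_def2 in Hn.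
  apply (Rmult_lt_reg_l (x ^ m)); lra.
Qed.

(** * Vanishing averages of the spread *)

Lemma newborn_spread_sqr_cv0 m W : (1 <= m)%nat -> is_BDMC W ->
  forall e, 0 < e -> exists n0, forall k, (n0 <= k)%nat ->
  newborn_total m W spread_sqr k <= e * INR (Ncount m k).
Proof.
  intros Hm HW e He; destruct (growth_root m Hm) as [x [Hx Ex]].
  assert (HD : forall k, 0 <= newborn_total m W spread_sqr k).
  { intros k; apply newborn_total_nonneg; [assumption|].
    intros V HV; pose proof (spread_bounds V HV); unfold spread_sqr; nra. }
  destruct (delayed_recurrence_loss_cv0 m x (total m W ln_1_plus_Z)
    (fun k => newborn_total m W spread_sqr k / 4) Hm (proj1 Hx) Ex) with (eps := e / 4)
    as [n0 Hn].
  - intros k; apply total_nonneg; [assumption|]; intros V HV; unfold ln_1_plus_Z.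
    pose proof (Zpar_nonneg V) as [H| <-].
    + rewrite <- ln_1; left; apply ln_increasing; lra.
    + rewrite Rplus_0_r, ln_1; lra.
  - intros k; specialize (HD k); lra.
  - intros k; now apply total_ln_step.
  - lra.
  - exists n0; intros k Hk; specialize (Hn k Hk); specialize (HD k).
    unfold Rdist in Hn; rewrite Rminus_0_r in Hn; apply Rabs_def2 in Hn.
    (* The weighted total is below [e], hence below [e * (x ^ k * N(k))]; then [x ^ k] cancels. *)
    pose proof (Ncount_growth m x k Hm Hx Ex) as Hg.
    pose proof (pow_lt x k (proj1 Hx)).
    apply (Rmult_le_reg_l (x ^ k)); [assumption|].
    nra.
Qed.

Lemma newborn_spread_cv0 m W : (1 <= m)%nat -> is_BDMC W ->
  forall e, 0 < e -> exists n0, forall k, (n0 <= k)%nat ->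
  newborn_total m W spread k <= e * INR (Ncount m k).
Proof.
  intros Hm HW e He.
  (* With [s <= e / 2 + (2 / e) * s^2], a bound [e * e / 4] on the squares leaves [e / 2] for each
     term. *)
  destruct (newborn_spread_sqr_cv0 m W Hm HW (e * e / 4)) as [n0 Hn]; [nra|].
  exists n0; intros k Hk; specialize (Hn k Hk).
  apply Rle_trans with (sum_range (fun j =>
    e / 2 + 2 / e * spread_sqr (bit_channel m W k j)) (Ncount m (pred k)) (Ncount m k)).
  - apply sum_range_le; intros j _; unfold spread_sqr.
    set (s := spread _).
    apply (Rmult_le_reg_l e); [assumption|].
    replace (e * (e / 2 + 2 / e * (s * s))) with (e * e / 2 + 2 * (s * s)) by (field; lra).
    pose proof (Rle_0_sqr (e - 2 * s)); unfold Rsqr in *; nra.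
  - rewrite sum_range_plus, sum_range_scal, sum_range_const by (apply Ncount_mono; lia).
    pose proof (pos_INR (Ncount m (pred k))).
    apply (Rmult_le_compat_l (2 / e)) in Hn;
      [|apply Rlt_le, Rdiv_lt_0_compat; lra].
    replace (2 / e * (e * e / 4 * INR (Ncount m k))) with (e / 2 * INR (Ncount m k)) in Hn
      by (field; lra).
    unfold newborn_total in Hn; nra.
Qed.

(* Among the indices present at time [k + A], those older than time [k] are
   few, and the younger ones inherit a small spread from their birth. *)
Lemma aged_spread_bound m W A : (1 <= m)%nat -> is_BDMC W ->
  forall a e, 0 < e -> exists n0, forall k, (n0 <= k)%nat ->
  sum_range (fun j => spread (bit_channel m W (k + A + a) j)) 0 (Ncount m (k + A)) <=
  INR (Ncount m k) + e * INR (Ncount m (k + A)).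
Proof.
  intros Hm HW; induction A as [|A IH]; intros a e He.
  - exists 0%nat; intros k _; rewrite Nat.add_0_r.
    pose proof (INR_Ncount_pos m k Hm).
    apply Rle_trans with (sum_range (fun _ => 1) 0 (Ncount m k)).
    + apply sum_range_le; intros j _; apply spread_bounds, bit_channel_BDMC, HW.
    + rewrite sum_range_const by lia; simpl INR; nra.
  (* At time [k + S A + a], the indices already present at time [k + A] have spent [S a] further
     steps, hence the general [a] in the induction. *)
  - destruct (IH (S a) (e / 2) ltac:(lra)) as [n1 H1].
    assert (P : 0 < 2 ^ a) by (apply pow_lt; lra).
    (* The division by [2 ^ a] compensates the growth of the spread over [a] steps. *)
    destruct (newborn_spread_cv0 m W Hm HW (e / 2 / 2 ^ a)) as [n2 H2].
    { apply Rdiv_lt_0_compat; lra. }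
    exists (max n1 n2); intros k Hk.
    specialize (H1 k ltac:(lia)); specialize (H2 (k + S A)%nat ltac:(lia)).
    rewrite Nat.add_succ_r in *.
    assert (Hmon := Ncount_mono m (k + A) (S (k + A)) Hm ltac:(lia)).
    rewrite (sum_range_split _ 0 (Ncount m (k + A))) by lia.
    assert (H3 : sum_range (fun j => spread (bit_channel m W (S (k + A) + a) j))
              (Ncount m (k + A)) (Ncount m (S (k + A)))
            <= 2 ^ a * newborn_total m W spread (S (k + A))).
    { unfold newborn_total; rewrite <- sum_range_scal.
      apply sum_range_le; intros j Hj; now apply newborn_spread_growth. }
    apply (Rmult_le_compat_l (2 ^ a)) in H2; [|lra].
    replace (2 ^ a * (e / 2 / 2 ^ a * INR (Ncount m (S (k + A)))))
      with (e / 2 * INR (Ncount m (S (k + A)))) in H2 by (field; lra).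
    apply le_INR in Hmon.
    change (S (k + A) + a)%nat with (S (k + A + a)) in *.
    nra.
Qed.

Lemma total_spread_cv0 m W : (1 <= m)%nat -> is_BDMC W ->
  forall e, 0 < e -> exists n0, forall n, (n0 <= n)%nat ->
  total m W spread n <= e * INR (Ncount m n).
Proof.
  intros Hm HW e He.
  (* With [(/ 2) ^ B < e / 2], doubling makes the indices older than [m * B] steps a fraction below
     [e / 2]. *)
  destruct (pow_lt_1_zero (/ 2) ltac:(rewrite Rabs_pos_eq; lra) (e / 2) ltac:(lra))
    as [B HB].
  specialize (HB B ltac:(lia)); rewrite Rabs_pos_eq, pow_inv in HB by (apply pow_le; lra).
  destruct (aged_spread_bound m W (m * B) Hm HW 0 (e / 2) ltac:(lra)) as [n0 Hn].
  exists (n0 + m * B)%nat; intros n Hge.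
  specialize (Hn (n - m * B)%nat ltac:(lia)).
  rewrite Nat.add_0_r in Hn.
  pose proof (Ncount_double m (n - m * B) B Hm) as Hd; apply le_INR in Hd.
  replace (n - m * B + m * B)%nat with n in * by lia.
  rewrite mult_INR, pow_INR in Hd; change (INR 2) with 2 in Hd.
  assert (P : 0 < 2 ^ B) by (apply pow_lt; lra).
  assert (INR (Ncount m (n - m * B)) <= e / 2 * INR (Ncount m n)).
  { apply Rle_trans with (/ 2 ^ B * INR (Ncount m n)).
    - apply (Rmult_le_reg_l (2 ^ B)); [assumption|].
      rewrite <- Rmult_assoc, Rinv_r by lra; lra.
    - pose proof (INR_Ncount_pos m n Hm); nra. }
  unfold total; lra.
Qed.

(** * From the spread to the threshold counts *)

Lemma threshold_error e V h : 0 < e <= / 2 -> is_BDMC V -> 0 <= h <= 1 ->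
  (1 - e < I V -> h = 1) -> (I V < e -> h = 0) ->
  Rabs (h - I V) <= (2 * (2 / ln 2) + Rsqr (2 / ln 2 / e)) * spread V.
Proof.
  intros He HV Hh H1 H0; unfold spread.
  destruct (I_bounds V HV) as [BI [U L]].
  pose proof (Zpar_nonneg V) as Z0; pose proof (Zpar_le_1 V HV) as Z1.
  pose proof ln2_pos as P2.
  assert (Hc : 2 <= 2 / ln 2).
  { apply (Rmult_le_reg_r (ln 2)); [assumption|].
    replace (2 / ln 2 * ln 2) with 2 by (field; lra).
    pose proof (ln_le_sub1 2 ltac:(lra)); lra. }
  set (c := 2 / ln 2) in *; set (z := Zpar V) in *.
  assert (Pr : 0 <= Rsqr (c / e)) by apply Rle_0_sqr.
  assert (Hg : 0 <= z * (1 - z)) by nra.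
  assert (Hbig : forall x, 0 <= x -> x <= 2 * c * (z * (1 - z)) ->
            x <= (2 * c + Rsqr (c / e)) * (z * (1 - z))) by (intros; nra).
  (* If [c * z < e] then [I V > 1 - e], so the error is [1 - I V <= c * z]; as [z <= / 2], the
     factor [2 * (1 - z)] costs nothing. The next case is symmetric. *)
  destruct (Rlt_le_dec (c * z) e) as [Ha|Ha].
  { rewrite H1 by lra; apply Hbig; [apply Rabs_pos|].
    rewrite Rabs_pos_eq by lra. assert (z <= / 2) by nra. nra. }
  destruct (Rlt_le_dec (c * (1 - z)) e) as [Hb|Hb].
  { rewrite H0 by lra; apply Hbig; [apply Rabs_pos|].
    rewrite Rabs_left1 by lra. assert (1 - z <= / 2) by nra. nra. }
  (* Now [z] and [1 - z] are both at least [e / c], so the squared constant times the spread exceeds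
     the trivial error bound [1]. *)
  apply Rle_trans with 1; [apply Rabs_le; lra|].
  apply Rle_trans with (Rsqr (c / e) * (z * (1 - z))); [|nra].
  assert (Q : forall y, e <= c * y -> 1 <= c / e * y).
  { intros y Hy; apply (Rmult_le_reg_l e); [lra|].
    replace (e * (c / e * y)) with (c * y) by (field; lra); lra. }
  pose proof (Q _ Ha); pose proof (Q _ Hb); unfold Rsqr; nra.
Qed.

(** The average of [I] is exactly [I W] at every time, so the deviation is at most [K] times the
    average spread. *)
Lemma average_cv m W h K : (1 <= m)%nat -> is_BDMC W -> 0 < K ->
  (forall V, is_BDMC V -> Rabs (h V - I V) <= K * spread V) ->
  Un_cv (fun n => total m W h n / INR (Ncount m n)) (I W).
Proof.
  intros Hm HW HK Hh e He.
  destruct (total_spread_cv0 m W Hm HW (e / 2 / K)) as [n0 Hn].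
  { repeat apply Rdiv_lt_0_compat; lra. }
  exists n0; intros n Hge; specialize (Hn n Hge).
  pose proof (INR_Ncount_pos m n Hm) as PN.
  assert (B : forall F G : channel -> R,
      (forall V, is_BDMC V -> F V <= G V + K * spread V) ->
      total m W F n <= total m W G n + K * total m W spread n).
  { intros F G HFG; unfold total; rewrite <- sum_range_scal, <- sum_range_plus.
    apply sum_range_le; intros j _; apply HFG, bit_channel_BDMC, HW. }
  assert (B1 := B h I); assert (B2 := B I h); clear B.
  assert (A1 : total m W h n <= total m W I n + K * total m W spread n).
  { apply B1; intros V HV; specialize (Hh V HV).
    pose proof (Rle_abs (h V - I V)); lra. }
  assert (A2 : total m W I n <= total m W h n + K * total m W spread n).
  { apply B2; intros V HV; specialize (Hh V HV); rewrite Rabs_minus_sym in Hh.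
    pose proof (Rle_abs (I V - h V)); lra. }
  rewrite total_I in A1, A2 by assumption.
  apply (Rmult_le_compat_l K) in Hn; [|lra].
  replace (K * (e / 2 / K * INR (Ncount m n))) with (e / 2 * INR (Ncount m n)) in Hn
    by (field; lra).
  unfold Rdist; replace (total m W h n / INR (Ncount m n) - I W)
    with ((total m W h n - INR (Ncount m n) * I W) / INR (Ncount m n)) by (field; lra).
  apply Rle_lt_trans with (e / 2); [|lra].
  apply Rabs_le; split; apply (Rmult_le_reg_r (INR (Ncount m n))); try assumption;
    unfold Rdiv at 2; unfold Rdiv; rewrite ?Rmult_assoc, ?Rinv_l by lra; lra.
Qed.

Theorem theorem1 (m : nat) (W : channel) (d : R) :
  (1 <= m)%nat -> is_BDMC W -> 0 < d < 1 ->
  Un_cv (fun n => INR (count_high m W d n) / INR (Ncount m n)) (I W) /\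
  Un_cv (fun n => INR (count_low m W d n) / INR (Ncount m n)) (1 - I W).
Proof.
  intros Hm HW Hd.
  (* The minimum of [d] and [1 - d] is at most [/ 2] and separates the two ends for both counts:
     [e <= d] gives the right value at the near end, [e <= 1 - d] at the far end. *)
  assert (He : exists e, 0 < e <= / 2 /\ e <= d /\ e <= 1 - d).
  { exists (Rmin d (1 - d)); unfold Rmin; destruct (Rle_dec d (1 - d)); lra. }
  destruct He as [e [He [Hed Hed']]].
  set (K := 2 * (2 / ln 2) + Rsqr (2 / ln 2 / e)).
  assert (HK : 0 < K).
  { pose proof (Rdiv_lt_0_compat 2 (ln 2) ltac:(lra) ln2_pos).
    pose proof (Rle_0_sqr (2 / ln 2 / e)); unfold K; lra. }
  split.
  - apply (Un_cv_ext (fun n =>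
      total m W (fun V => if in_high d (I V) then 1 else 0) n / INR (Ncount m n))).
    + intros n; f_equal; unfold count_high.
      now rewrite length_filter_sumR, <- total_Slist.
    + apply (average_cv m W _ K Hm HW HK); intros V HV.
      pose proof (I_bounds V HV) as [BI _].
      apply threshold_error; try assumption; unfold in_high;
        destruct (Rlt_dec (1 - d) (I V)), (Rle_dec (I V) 1); lra.
  (* The complement of the low indicator is also [1] near [I V = 1] and [0] near [I V = 0], so
     [average_cv] applies to it; its total is [N(n)] minus the low count. *)
  - set (h := fun V => 1 - if in_low d (I V) then 1 else 0).
    assert (C : Un_cv (fun n => total m W h n / INR (Ncount m n)) (I W)).
    { apply (average_cv m W _ K Hm HW HK); intros V HV.
      pose proof (I_bounds V HV) as [BI _].
      apply threshold_error; try assumption; unfold h, in_low;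
        destruct (Rle_dec 0 (I V)), (Rlt_dec (I V) d); lra. }
    intros eps Heps; destruct (C eps Heps) as [n0 Hn].
    exists n0; intros n Hge; specialize (Hn n Hge).
    assert (E : total m W h n = INR (Ncount m n) - INR (count_low m W d n)).
    { unfold count_low; rewrite length_filter_sumR.
      rewrite (total_Slist m W (fun V => if in_low d (I V) then 1 else 0)) by assumption.
      unfold total, h.
      rewrite (sum_range_ext _ (fun j =>
        1 + -1 * (if in_low d (I (bit_channel m W n j)) then 1 else 0)))
        by (intros; ring).
      rewrite sum_range_plus, sum_range_scal, sum_range_const by lia; simpl INR; ring. }
    pose proof (INR_Ncount_pos m n Hm).
    unfold Rdist in *; rewrite <- Rabs_Ropp, E in Hn.
    replace (INR (count_low m W d n) / INR (Ncount m n) - (1 - I W))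
      with (- ((INR (Ncount m n) - INR (count_low m W d n)) / INR (Ncount m n) - I W))
      by (field; lra).
    exact Hn.
Qed.
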